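(* Let $\Gamma$ be a graph in the class $\mathcal{GP}$. Then the corresponding graph group $G(\Gamma)$ is (isomorphic to) a subgroup of Thompson's group $V$.
   Context: A finite simple graph $\Gamma$ consists of a finite set $V(\Gamma)$ of vertices and a set $E(\Gamma)$ of (undirected) edges, with no loops and no multiple edges. The eccentricity $\epsilon(v)$ of a vertex $v$ is the greatest geodesic distance between $v$ and any other vertex of $\Gamma$ (vertices in different connected components are at infinite distance). In particular, $\epsilon(v)=1$ exactly when $\Gamma$ has at least one vertex other than $v$ and $v$ is adjacent to every other vertex. $\mathcal{GP}$ is the class of all finite simple graphs $\Gamma$ for which there exists a partition $P_0,P_1,\dots,P_n$ (for some $n\ge 0$) of $V(\Gamma)$, with all parts except perhaps $P_0$ nonempty, such that: (i) $P_0$ is the set of all vertices of $\Gamma$ with eccentricity one; (ii) if $v_i,v_j\in P_k$ with $k>0$, then $(v_i,v_j)\notin E(\Gamma)$; (iii) if $v_i\in P_i$ and $v_j\in P_j$ with $i\neq j$, then $(v_i,v_j)\in E(\Gamma)$. Such a partition is called a commuting partition. For a finite simple graph $\Gamma$, the graph group (right-angled Artin group) $G(\Gamma)$ is the group with one generator $x_v$ for each vertex $v$ of $\Gamma$ and defining relations $x_ux_v=x_vx_u$ for each edge $(u,v)\in E(\Gamma)$, and no other relations. Thompson's group $V$ is the group of homeomorphisms of the Cantor set $\{0,1\}^{\mathbb{N}}$ that can be expressed as a finite list of prefix replacements: $f\in V$ if and only if there are finite lists of finite binary words $u_1,\dots,u_m$ and $w_1,\dots,w_m$ such that each infinite binary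 sequence has exactly one of the $u_i$ as a prefix and exactly one of the $w_i$ as a prefix, and $f(u_i z)=w_i z$ for all $i$ and all $z\in\{0,1\}^{\mathbb{N}}$. *)

(* Defs.v *)
From HB Require Import structures.
From mathcomp Require Import all_boot.
From mathcomp Require Import boolp classical_sets topology cantor.

Set Implicit Arguments.
Unset Strict Implicit.
Unset Printing Implicit Defensive.

Local Open Scope group_scope.


Record sgraph := SGraph {
  svertex :> finType;
  sedge : rel svertex;
  sedge_sym : symmetric sedge;
  sedge_irr : irreflexive sedge }.

Section Eccentricity.
Variable G : sgraph.
Implicit Types u v : G.

Definition walk u v (n : nat) : bool :=
  [exists p : n.-tuple G, path (@sedge G) u p && (last u p == v)].

(* Distances live in [option nat], with [None] standing for infinity. *)
Definition geodist u v : option nat :=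
  if pselect (exists n, walk u v n) is left uv
  then Some (ex_minn uv) else None.

Definition maxdist (a b : option nat) : option nat :=
  if a is Some m then if b is Some n then Some (maxn m n) else None else None.

Definition eccentricity v : option nat :=
  \big[maxdist/Some 0%N]_(w | w != v) geodist v w.

End Eccentricity.

Definition commuting_partition (G : sgraph) n (P : 'I_n.+1 -> {set G}) : Prop :=
  [/\ forall v : G, exists! k, v \in P k,
      forall k, k != ord0 -> P k != finset.set0,
      P ord0 = [set v | eccentricity v == Some 1%N],
      forall k, k != ord0 -> {in P k &, forall u v, ~~ sedge u v}
    & forall i j, i != j -> {in P i & P j, forall u v, sedge u v}].

Definition in_GP (G : sgraph) : Prop :=
  exists n (P : 'I_n.+1 -> {set G}), commuting_partition P.


Section Presentation.
Variable X : choiceType.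

(* The letter [(x, true)] is the generator x, and [(x, false)] its inverse. *)
Definition gword := seq (X * bool).

Variable rel : gword -> gword -> Prop.

Inductive pres_equiv : gword -> gword -> Prop :=
| pres_rel u v : rel u v -> pres_equiv u v
| pres_cancel x b : pres_equiv [:: (x, b); (x, ~~ b)] [::]
| pres_refl u : pres_equiv u u
| pres_sym u v : pres_equiv u v -> pres_equiv v u
| pres_trans v u w : pres_equiv u v -> pres_equiv v w -> pres_equiv u w
| pres_cat u u' v v' :
    pres_equiv u u' -> pres_equiv v v' -> pres_equiv (u ++ v) (u' ++ v').

Definition pres_eqb (u v : gword) : bool := `[< pres_equiv u v >].

Lemma pres_eqb_refl : reflexive pres_eqb.
Proof. by move=> u; apply/asboolP; exact: pres_refl. Qed.

Lemma pres_eqb_sym : symmetric pres_eqb.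
Proof. by move=> u v; apply/asboolP/asboolP; exact: pres_sym. Qed.

Lemma pres_eqb_trans : transitive pres_eqb.
Proof.
by move=> v u w /asboolP uv /asboolP vw; apply/asboolP; exact: pres_trans uv vw.
Qed.

Canonical pres_equiv_rel :=
  EquivRel pres_eqb pres_eqb_refl pres_eqb_sym pres_eqb_trans.

Definition presented_group : Type := {eq_quot pres_eqb}%qT.
HB.instance Definition _ := Choice.on presented_group.
HB.instance Definition _ := EqQuotient.on presented_group.

Definition pres_class (u : gword) : presented_group := (\pi_presented_group u)%qT.

Lemma pres_classP u v : pres_class u = pres_class v <-> pres_equiv u v.
Proof.
by split=> [/eqmodP /asboolP //|uv]; apply/eqmodP/asboolP.
Qed.

Lemma pres_classW (P : presented_group -> Prop) :
  (forall u, P (pres_class u)) -> forall g, P g.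
Proof. by move=> Pu g; rewrite -[g]reprK; exact: Pu. Qed.

Definition inv_word (u : gword) : gword :=
  [seq (a.1, ~~ a.2) | a <- rev u].

Definition pres_mul (g h : presented_group) : presented_group :=
  pres_class (repr g ++ repr h).
Definition pres_one : presented_group := pres_class [::].
Definition pres_inv (g : presented_group) : presented_group :=
  pres_class (inv_word (repr g)).

Lemma repr_class u : pres_equiv (repr (pres_class u)) u.
Proof. by apply/pres_classP; rewrite /pres_class reprK. Qed.

Lemma pres_mulE u v :
  pres_mul (pres_class u) (pres_class v) = pres_class (u ++ v).
Proof. by apply/pres_classP; apply: pres_cat; exact: repr_class. Qed.

Lemma inv_wordK u : pres_equiv (u ++ inv_word u) [::].
Proof.
elim: u => [|[x b] u IH]; first exact: pres_refl.
have -> : ((x, b) :: u) ++ inv_word ((x, b) :: u) =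
    [:: (x, b)] ++ ((u ++ inv_word u) ++ [:: (x, ~~ b)]).
  by rewrite /inv_word rev_cons map_rcons -cats1 /= !catA.
apply: (@pres_trans ([:: (x, b)] ++ ([::] ++ [:: (x, ~~ b)]))); last first.
  exact: pres_cancel.
apply: pres_cat; first exact: pres_refl.
by apply: pres_cat IH _; exact: pres_refl.
Qed.

Lemma inv_word_inv u : inv_word (inv_word u) = u.
Proof.
rewrite /inv_word -map_rev revK -map_comp -[RHS]map_id.
by apply: eq_map => -[x b] /=; rewrite negbK.
Qed.

Lemma inv_wordVK u : pres_equiv (inv_word u ++ u) [::].
Proof. by rewrite -{2}[u]inv_word_inv; exact: inv_wordK. Qed.

Lemma pres_mulA : associative pres_mul.
Proof.
elim/pres_classW=> u; elim/pres_classW=> v; elim/pres_classW=> w.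
by rewrite !pres_mulE catA.
Qed.

Lemma pres_mul1 : left_id pres_one pres_mul.
Proof. by elim/pres_classW=> u; rewrite pres_mulE. Qed.

Lemma pres_mulr1 : right_id pres_one pres_mul.
Proof. by elim/pres_classW=> u; rewrite pres_mulE cats0. Qed.

Lemma pres_mulV : left_inverse pres_one pres_inv pres_mul.
Proof.
move=> g; rewrite -{2}[g]reprK pres_mulE.
by apply/pres_classP; exact: inv_wordVK.
Qed.

Lemma pres_mulrV : right_inverse pres_one pres_inv pres_mul.
Proof.
move=> g; rewrite -{1}[g]reprK pres_mulE.
by apply/pres_classP; exact: inv_wordK.
Qed.

HB.instance Definition _ := isGroup.Build presented_group
  pres_mulA pres_mul1 pres_mulr1 pres_mulV pres_mulrV.

End Presentation.

Inductive commutation_rel (G : sgraph) : gword G -> gword G -> Prop :=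
| Commutation (u v : G) : sedge u v ->
    commutation_rel [:: (u, true); (v, true)] [:: (v, true); (u, true)].

Definition graph_group (G : sgraph) : groupType :=
  presented_group (@commutation_rel G).


Record homeo (X : topologicalType) := Homeo {
  homeo_fun :> X -> X;
  homeo_inv : X -> X;
  homeoK : cancel homeo_fun homeo_inv;
  homeoVK : cancel homeo_inv homeo_fun;
  homeo_cont : continuous homeo_fun;
  homeoV_cont : continuous homeo_inv }.

Section HomeoGroup.
Variable X : topologicalType.
Implicit Types f g : homeo X.

HB.instance Definition _ := gen_eqMixin (homeo X).
HB.instance Definition _ := gen_choiceMixin (homeo X).

Lemma homeoP f g : f =1 g -> f = g.
Proof.
move: f g => [f f' fK f'K cf cf'] [g g' gK g'K cg cg'] /= fg.
have ? : f = g by apply/funext.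
subst g; have ? : f' = g'.
  by apply/funext => x; rewrite -{1}[x]g'K fK.
by subst g'; congr Homeo; exact: Prop_irrelevance.
Qed.

Lemma homeo_comp_cont (f g : X -> X) :
  continuous f -> continuous g -> continuous (f \o g).
Proof. by move=> cf cg x; apply: continuous_comp; [exact: cg | exact: cf]. Qed.

Lemma homeo_id_cont : continuous (@id X).
Proof. by move=> x; exact: cvg_id. Qed.

Definition homeo_one : homeo X :=
  @Homeo X id id (fun=> erefl) (fun=> erefl) homeo_id_cont homeo_id_cont.
Definition homeo_mul f g : homeo X :=
  Homeo (can_comp (homeoK f) (homeoK g))
        (can_comp (homeoVK g) (homeoVK f))
        (homeo_comp_cont (@homeo_cont _ f) (@homeo_cont _ g))
        (homeo_comp_cont (@homeoV_cont _ g) (@homeoV_cont _ f)).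
Definition homeo_opp f : homeo X :=
  Homeo (homeoVK f) (homeoK f) (@homeoV_cont _ f) (@homeo_cont _ f).

Lemma homeo_mulA : associative homeo_mul.
Proof. by move=> f g h; apply: homeoP. Qed.
Lemma homeo_mul1 : left_id homeo_one homeo_mul.
Proof. by move=> f; apply: homeoP. Qed.
Lemma homeo_mulr1 : right_id homeo_one homeo_mul.
Proof. by move=> f; apply: homeoP. Qed.
Lemma homeo_mulV : left_inverse homeo_one homeo_opp homeo_mul.
Proof. by move=> f; apply: homeoP => x /=; rewrite homeoK. Qed.
Lemma homeo_mulrV : right_inverse homeo_one homeo_opp homeo_mul.
Proof. by move=> f; apply: homeoP => x /=; rewrite homeoVK. Qed.

HB.instance Definition _ := isGroup.Build (homeo X)
  homeo_mulA homeo_mul1 homeo_mulr1 homeo_mulV homeo_mulrV.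

End HomeoGroup.

(* The infinite word u z: [nth] returns its default value [z (i - size u)]
   exactly when [size u <= i]. *)
Definition cat_word (u : seq bool) (z : cantor_space) : cantor_space :=
  fun i => nth (z (i - size u)%N) u i.

Definition is_prefix (u : seq bool) (x : cantor_space) : Prop :=
  exists z, x = cat_word u z.

Definition complete_prefix_code m (u : 'I_m -> seq bool) : Prop :=
  forall x : cantor_space, exists! i, is_prefix (u i) x.

Definition prefix_replacement (f : cantor_space -> cantor_space) : Prop :=
  exists m (u w : 'I_m -> seq bool),
    [/\ complete_prefix_code u, complete_prefix_code w
      & forall i z, f (cat_word (u i) z) = cat_word (w i) z].

Definition thompson_pred : {pred homeo cantor_space} :=
  fun f => `[< prefix_replacement f >].

Lemma cat_word_cat u v z : cat_word (u ++ v) z = cat_word u (cat_word v z).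
Proof.
apply/funext => i; rewrite /cat_word nth_cat size_cat subnDA.
case: ltnP => iu; first by apply: set_nth_default.
by rewrite [RHS]nth_default.
Qed.

Definition take_word n (x : cantor_space) : seq bool := mkseq x n.

Lemma take_wordE n x :
  x = cat_word (take_word n x) (fun i => x (n + i)%N).
Proof.
apply/funext => i; rewrite /cat_word size_mkseq.
case: (ltnP i n) => [lt_in|le_ni]; first by rewrite nth_mkseq.
by rewrite nth_default ?size_mkseq// subnKC.
Qed.

Lemma take_cat_word u z : take_word (size u) (cat_word u z) = u.
Proof.
apply: (@eq_from_nth _ false); rewrite size_mkseq// => i iu.
by rewrite nth_mkseq// /cat_word; exact: set_nth_default.
Qed.

Lemma cat_word_inj u : injective (cat_word u).
Proof.
move=> y z /funeqP yz; apply/funext => i; move: (yz (size u + i)%N).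
by rewrite /cat_word !nth_default ?leq_addr// addKn.
Qed.

Definition prefix_at (f : cantor_space -> cantor_space) n :=
  forall a : seq bool, size a = n ->
    exists w, forall z, f (cat_word a z) = cat_word w z.

Lemma prefix_atS f n k : prefix_at f n -> prefix_at f (n + k)%N.
Proof.
move=> fn a sa; have [|w fw] := fn (take n a); first by rewrite size_takel// sa leq_addr.
exists (w ++ drop n a) => z.
by rewrite -{1}(cat_take_drop n a) !cat_word_cat fw.
Qed.

Lemma prefix_replacement_at f :
  prefix_replacement f -> exists n, prefix_at f n.
Proof.
move=> [m [u [w [cu _ fuw]]]]; exists (\max_(i < m) size (u i)) => a sa.
have [i [[z az] _]] := cu (cat_word a (fun=> false)).
have le_ia : (size (u i) <= size a)%N by rewrite sa leq_bigmax.
have ai : take (size (u i)) a = u i.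
  rewrite -[RHS](take_cat_word _ z) -az -{2}(cat_take_drop (size (u i)) a).
  rewrite cat_word_cat -{2}(size_takel le_ia).
  by rewrite take_cat_word.
exists (w i ++ drop (size (u i)) a) => y.
rewrite -{1}(cat_take_drop (size (u i)) a) ai !cat_word_cat.
exact: fuw.
Qed.

Lemma prefix_at_replacement f n :
  bijective f -> prefix_at f n -> prefix_replacement f.
Proof.
move=> [g fK gK] /= fn.
have wP (a : n.-tuple bool) : exists w, forall z, f (cat_word a z) = cat_word w z.
  by apply: fn; rewrite size_tuple.
pose w a := projT1 (cid (wP a)).
have fw (a : n.-tuple bool) z : f (cat_word a z) = cat_word (w a) z.
  by rewrite /w; case: cid.
have cn (x : cantor_space) : exists! i : 'I_#|{: n.-tuple bool}|,
    is_prefix (enum_val i : n.-tuple bool) x.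
  have sx : size (take_word n x) == n by rewrite size_mkseq.
  exists (enum_rank (Tuple sx)); split=> [|i [z xz]].
    by rewrite enum_rankK /=; exists (fun i => x (n + i)%N); exact: take_wordE.
  apply: (can_inj enum_valK); rewrite enum_rankK; apply: val_inj => /=.
  by rewrite xz -{1}(size_tuple (enum_val i)) take_cat_word.
exists #|{: n.-tuple bool}|, (fun i => tval (enum_val i)),
  (fun i => w (enum_val i)).
split=> //.
move=> x; have [i [[z gz] iU]] := cn (g x); exists i; split.
  by exists z; rewrite -fw -gz gK.
by move=> j [y xy]; apply: iU; exists y; rewrite xy -fw fK.
Qed.

Lemma thompson_group_closed : group_closed thompson_pred.
Proof.
split; first by apply/asboolP/(@prefix_at_replacement _ 0);
  [exact: inv_bij | move=> a _; exists a].
move=> f g /asboolP Vf /asboolP Vg; apply/asboolP.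
have {}Vg : prefix_replacement (g^-1 : homeo _).
  have [m [u [w [cu cw guw]]]] := Vg; exists m, w, u; split=> // i z.
  by rewrite -guw; exact: homeoK.
have [n fn] := prefix_replacement_at Vf.
have [k gk] := prefix_replacement_at Vg.
apply: (@prefix_at_replacement _ (k + n)).
  by exists (homeo_inv (f / g)); [exact: homeoK | exact: homeoVK].
move=> a sa; have [|b gb] := gk (take k a).
  by rewrite size_takel// sa leq_addr.
have sb : size (b ++ drop k a) = (n + size b)%N.
  by rewrite size_cat size_drop sa addKn addnC.
have [c fc] := prefix_atS (k := size b) fn sb.
exists c => z; rewrite -fc cat_word_cat -gb -cat_word_cat cat_take_drop.
by [].
Qed.

Definition thompsonV : Type := {f : homeo cantor_space | f \in thompson_pred}.
HB.instance Definition _ := SubChoice.on thompsonV.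
HB.instance Definition _ := SubChoice_isSubGroup.Build
  (homeo cantor_space) thompson_pred thompsonV thompson_group_closed.

(* Main.v *)
(* G is complete multipartite, so its graph group is the direct product of the
   free groups on its classes (each central vertex being a class by itself).
   Each class gets its own cone of the Cantor space, disjoint from the others,
   and its vertices act there by hyperbolic elements of V with disjoint
   attracting and repelling cones; the ping-pong argument, applied to a base
   point outside of all these cones, shows that the action is faithful. *)

Require Import Defs.
From HB Require Import structures.
From mathcomp Require Import all_boot.
From mathcomp Require Import boolp classical_sets topology cantor.

Set Implicit Arguments.
Unset Strict Implicit.
Unset Printing Implicit Defensive.

Local Open Scope group_scope.

(** * Evaluation of words in a group *)

Section WordEvaluation.
Variables (X : choiceType) (H : groupType) (h : X -> H).

Definition letter_eval (a : X * bool) : H := if a.2 then h a.1 else (h a.1)^-1.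
Definition word_eval (w : gword X) : H := \prod_(a <- w) letter_eval a.

Lemma word_eval_cat u v : word_eval (u ++ v) = word_eval u * word_eval v.
Proof. exact: big_cat. Qed.

Lemma word_eval_cons a w : word_eval (a :: w) = letter_eval a * word_eval w.
Proof. exact: big_cons. Qed.

Lemma word_eval_nil : word_eval [::] = 1.
Proof. exact: big_nil. Qed.

Lemma word_eval_equiv (rel : gword X -> gword X -> Prop) :
  (forall u v, rel u v -> word_eval u = word_eval v) ->
  forall u v, pres_equiv rel u v -> word_eval u = word_eval v.
Proof.
move=> hrel u v; elim=> {u v} //.
- by move=> x b; rewrite /word_eval !big_cons !big_nil mulg1 /letter_eval;
    case: b; rewrite /= (mulgV, mulVg).
- by move=> u v w _ -> _ ->.
- by move=> u u' v v' _ IHu _ IHv; rewrite !word_eval_cat IHu IHv.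
Qed.

(** Each letter is a product of two factors, one of them 1: itself then 1 if [P] holds, 1 then
    itself otherwise. The commutation hypothesis lets the first factors be gathered on the left. *)
Lemma word_eval_split (P : pred (X * bool)) w :
  (forall a b, P a -> ~~ P b -> commute (letter_eval a) (letter_eval b)) ->
  word_eval w =
    word_eval [seq a <- w | P a] * word_eval [seq a <- w | ~~ P a].
Proof.
move=> cP; rewrite /word_eval !big_filter.
rewrite [X in _ = X * _]big_mkcond [X in _ = _ * X]big_mkcond /=.
rewrite -(@prodgM_commute _ _ _ predT) => [|a b _ _] /=.
  by apply: eq_bigr => a _; case: (P a); rewrite /= ?mulg1 ?mul1g.
case: ifP => [Pa|_]; last by apply: commute_sym; exact: commute1.
by case: ifPn => [Pb|_]; [exact: cP | exact: commute1].
Qed.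

Lemma letter_eval_commute a b :
  commute (h a.1) (h b.1) -> commute (letter_eval a) (letter_eval b).
Proof.
rewrite /letter_eval => cab; case: a.2; case: b.2 => //.
- exact: commuteV.
- by apply/commute_sym/commuteV/commute_sym.
- by apply/commuteV/commute_sym/commuteV/commute_sym.
Qed.

End WordEvaluation.

(** * The universal property of a presentation *)

Section PresentedGroup.
Variables (X : choiceType) (rel : gword X -> gword X -> Prop).

Definition pres_gen (x : X) : presented_group rel := pres_class rel [:: (x, true)].

(** This makes the evaluation lemmas, valid in every group, applicable inside the presented group
    itself. *)
Lemma pres_class_eval w : pres_class rel w = word_eval pres_gen w.
Proof.
elim: w => [|[x b] w IH]; first by rewrite word_eval_nil.
rewrite word_eval_cons -IH -cat1s -pres_mulE; congr (_ * _).
rewrite /letter_eval; case: b => //=; apply/esym/mulg1_eq.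
by rewrite [LHS]pres_mulE; apply/pres_classP; exact: pres_cancel.
Qed.

Variables (H : groupType) (h : X -> H).
Hypothesis hrel : forall u v, rel u v -> word_eval h u = word_eval h v.

Definition pres_lift (g : presented_group rel) : H := word_eval h (repr g).

Lemma pres_lift_class w : pres_lift (pres_class rel w) = word_eval h w.
Proof. by apply: (word_eval_equiv hrel); exact: repr_class. Qed.

Lemma pres_liftM : {morph pres_lift : x y / x * y}.
Proof. by move=> x y; rewrite pres_lift_class word_eval_cat. Qed.

Lemma pres_embeds : (forall w, word_eval h w = 1 -> pres_equiv rel w [::]) ->
  exists f : {multiplicative presented_group rel -> H}, injective f.
Proof.
move=> faithful.
have lift1 : pres_lift 1 = 1 by rewrite [LHS]pres_lift_class word_eval_nil.
pose f : UMagmaMorphism.type (presented_group rel) H := HB.pack pres_lift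
  (isUMagmaMorphism.Build _ _ pres_lift (conj lift1 pres_liftM)).
exists f; apply: (gmulf_inj (f := f)); elim/pres_classW => w fw.
by apply/pres_classP/faithful; rewrite -pres_lift_class.
Qed.

End PresentedGroup.

(** * Free reduction of words *)

Section FreeReduction.
Variables (X : choiceType) (rel : gword X -> gword X -> Prop).

Definition inv_letter (a : X * bool) := (a.1, ~~ a.2).
Definition reduced (w : gword X) := sorted (fun a b => b != inv_letter a) w.

(** A letter put before a reduced word either keeps it reduced or cancels its head. The inclusion of
    letters keeps the reduced form within one class of vertices. *)
Lemma free_reduction w : exists r,
  [/\ pres_equiv rel w r, reduced r & {subset r <= w}].
Proof.
elim: w => [|a w [r [wr rr sr]]]; first by exists [::]; split=> //; exact: pres_refl.
have awr : pres_equiv rel (a :: w) (a :: r).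
  by rewrite -cat1s -[a :: r]cat1s; apply: pres_cat => //; exact: pres_refl.
case: r => [|b r] in wr rr sr awr *.
  by exists [:: a]; split=> // x; rewrite inE => /eqP->; exact: mem_head.
have [eb|nb] := eqVneq b (inv_letter a); last first.
  exists (a :: b :: r); split=> //; first by rewrite /reduced /= nb.
  by move=> x; rewrite inE => /predU1P[->|/sr xw]; rewrite inE ?eqxx ?xw ?orbT.
exists r; split; [|exact: path_sorted rr|].
  apply: pres_trans awr _.
  rewrite -(cat1s b) -cat1s catA -[X in pres_equiv _ _ X]cat0s.
  apply: pres_cat; last exact: pres_refl.
  by rewrite eb; case: a {eb} => x c; exact: pres_cancel.
by move=> x xr; rewrite inE sr ?orbT// inE xr orbT.
Qed.

End FreeReduction.

(** * Hyperbolic elements of Thompson's group supported in a cone *)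

Section PrefixMaps.
Implicit Types (c d p q u : seq bool) (x y z : cantor_space).

Definition drop_word n x : cantor_space := fun i => x (n + i)%N.

Lemma cat_take_drop_word n x : cat_word (take_word n x) (drop_word n x) = x.
Proof. by rewrite -take_wordE. Qed.

Lemma drop_cat_word u z : drop_word (size u) (cat_word u z) = z.
Proof.
by apply: (@cat_word_inj u); rewrite -{1}(take_cat_word u z) cat_take_drop_word.
Qed.

(* For incomparable p and q, a hyperbolic element with attracting cone p and
   repelling cone q, chosen so that exchanging p and q gives its inverse. *)
Definition tree_shift p q x : cantor_space :=
  if take_word (size q) x == q then
    let y := drop_word (size q) x in
    if take_word (size p) y == p
    then cat_word p (cat_word q (drop_word (size p) y)) else y
  else cat_word p x.

(** The map sends the complement of the cone [q] onto the cone [p] minus the cone [p ++ q], the cone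
    [q ++ p] onto [p ++ q], and the rest of [q] onto the complement of [p]. Exchanging [p] and [q]
    reverses the three pieces. *)
Lemma tree_shiftK p q : cancel (tree_shift p q) (tree_shift q p).
Proof.
move=> x; rewrite {2}/tree_shift; case: ifPn => [/eqP xq|xq] /=; last first.
  by rewrite /tree_shift take_cat_word eqxx drop_cat_word /= (negPf xq).
case: ifPn => [/eqP yp|yp]; rewrite /tree_shift; last first.
  by rewrite (negPf yp) -{1}xq cat_take_drop_word.
rewrite take_cat_word eqxx drop_cat_word take_cat_word eqxx drop_cat_word.
by rewrite -{1}yp cat_take_drop_word -{1}xq cat_take_drop_word.
Qed.

Lemma take_word_cat n (a : seq bool) z :
  size a = n -> take_word n (cat_word a z) = a.
Proof. by move=> <-; exact: take_cat_word. Qed.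

Lemma drop_word_cat n (a : seq bool) z :
  size a = n -> drop_word n (cat_word a z) = z.
Proof. by move=> <-; exact: drop_cat_word. Qed.

(** The first [size q + size p] letters of a point settle both tests in [tree_shift]. *)
Lemma tree_shift_prefix_at p q : prefix_at (tree_shift p q) (size q + size p).
Proof.
move=> a sa; pose a1 := take (size q) a; pose a2 := drop (size q) a.
have sa1 : size a1 = size q by rewrite size_takel// sa leq_addr.
have sa2 : size a2 = size p by rewrite size_drop sa addKn.
exists (if a1 == q then if a2 == p then p ++ q else a2 else p ++ a) => z.
rewrite -{1}(cat_take_drop (size q) a) -/a1 -/a2 cat_word_cat /tree_shift.
rewrite !(take_word_cat _ sa1, drop_word_cat _ sa1) /=.
rewrite !(take_word_cat _ sa2, drop_word_cat _ sa2).
by case: ifP => _; [case: ifP => _|]; rewrite -?cat_word_cat -?catA ?cat_take_drop.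
Qed.

Definition on_cone c (f : cantor_space -> cantor_space) x : cantor_space :=
  if take_word (size c) x == c then cat_word c (f (drop_word (size c) x)) else x.

Lemma on_cone_cat c f z : on_cone c f (cat_word c z) = cat_word c (f z).
Proof. by rewrite /on_cone take_cat_word eqxx drop_cat_word. Qed.

Lemma on_cone_out c f x : take_word (size c) x != c -> on_cone c f x = x.
Proof. by rewrite /on_cone => /negPf ->. Qed.

Lemma on_coneK c f g : cancel f g -> cancel (on_cone c f) (on_cone c g).
Proof.
move=> fK x; have [xc|xc] := eqVneq (take_word (size c) x) c; last first.
  by rewrite !on_cone_out.
by rewrite -(cat_take_drop_word (size c) x) xc !on_cone_cat fK.
Qed.

Lemma on_cone_prefix_at c f n :
  prefix_at f n -> prefix_at (on_cone c f) (size c + n).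
Proof.
move=> fn a sa; pose a1 := take (size c) a; pose a2 := drop (size c) a.
have sa1 : size a1 = size c by rewrite size_takel// sa leq_addr.
have [|w fw] := fn a2; first by rewrite size_drop sa addKn.
exists (if a1 == c then c ++ w else a) => z.
rewrite -{1}(cat_take_drop (size c) a) -/a1 -/a2 cat_word_cat /on_cone.
rewrite (take_word_cat _ sa1) (drop_word_cat _ sa1) fw -!cat_word_cat.
by case: ifP => _; rewrite // cat_take_drop.
Qed.

(** Distinct words of equal length have disjoint cones, so the two maps have disjoint supports. *)
Lemma on_cone_comm c d f g : size c = size d -> c != d ->
  forall x, on_cone c f (on_cone d g x) = on_cone d g (on_cone c f x).
Proof.
move=> cd ncd x; have [xc|xc] := eqVneq (take_word (size c) x) c.
  rewrite -(cat_take_drop_word (size c) x) xc on_cone_cat.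
  by rewrite !(@on_cone_out d) ?on_cone_cat// take_word_cat.
rewrite (on_cone_out _ xc) on_cone_out//.
have [xd|xd] := eqVneq (take_word (size d) x) d; last by rewrite on_cone_out.
rewrite -(cat_take_drop_word (size d) x) xd on_cone_cat cd take_cat_word.
by rewrite eq_sym.
Qed.

Lemma nbhs_take_word x n :
  nbhs x [set y | forall j, (j < n)%N -> x j = y j]%classic.
Proof.
elim: n => [|n IH]; first by apply: filterS filterT => y.
have xn : nbhs x [set y : cantor_space | y n = x n]%classic.
  exact: (@proj_continuous nat (fun=> bool) n x _ (discrete_set1 (x n))).
apply: filterS2 IH xn => y yn /= ynE j.
by rewrite ltnS leq_eqVlt => /predU1P[->|/yn].
Qed.

Lemma prefix_at_continuous f n : prefix_at f n -> continuous f.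
Proof.
move=> fn x; have [|w fw] := fn (take_word n x); first by rewrite size_mkseq.
have fE y : (forall j, (j < n)%N -> x j = y j) ->
    f y = cat_word w (drop_word n y).
  move=> xy; rewrite -fw -{1}(cat_take_drop_word n y); congr (f (cat_word _ _)).
  by apply/eq_in_map => j; rewrite mem_iota => /andP[_ /xy].
apply: (proj2 (@pointwise_cvgP nat bool _ (f x) _)) => i.
apply/discrete_cvg.
(* Letter [i] of the image is either a letter of [w] or the letter [n + (i - size w)] of the point,
   so [n + i.+1] letters determine it. *)
apply: filterS (nbhs_take_word x (n + i.+1)) => y xy /=.
rewrite !fE => [|//|j jn]; last by apply: xy; rewrite ltn_addr.
rewrite /cat_word; case: (ltnP i (size w)) => iw; first exact: set_nth_default.
rewrite !nth_default// /drop_word -xy// ltn_add2l ltnS leq_subr//.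
Qed.

Definition cone_shift_homeo c p q : homeo cantor_space :=
  Homeo (on_coneK c (tree_shiftK p q)) (on_coneK c (tree_shiftK q p))
    (prefix_at_continuous (on_cone_prefix_at (@tree_shift_prefix_at p q)))
    (prefix_at_continuous (on_cone_prefix_at (@tree_shift_prefix_at q p))).

Lemma cone_shift_subproof c p q : cone_shift_homeo c p q \in thompson_pred.
Proof.
apply/asboolP/prefix_at_replacement; last first.
  exact: on_cone_prefix_at (@tree_shift_prefix_at p q).
by exists (homeo_inv (cone_shift_homeo c p q)); [exact: homeoK | exact: homeoVK].
Qed.

Definition cone_shift c p q : thompsonV :=
  exist _ (cone_shift_homeo c p q) (cone_shift_subproof c p q).

End PrefixMaps.

Lemma thompsonV_mulE (f g : thompsonV) x : val (f * g) x = val f (val g x).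
Proof. by rewrite valM. Qed.

Lemma thompsonV_oneE x : val (1 : thompsonV) x = x.
Proof. by rewrite val1. Qed.

Lemma thompsonVP (f g : thompsonV) : val f =1 val g -> f = g.
Proof. by move=> fg; apply/val_inj/homeoP. Qed.

Lemma cone_shiftV c p q : (cone_shift c p q)^-1 = cone_shift c q p.
Proof.
apply: mulg1_eq; apply: thompsonVP => x; rewrite thompsonV_mulE thompsonV_oneE /=.
by rewrite on_coneK//; exact: tree_shiftK.
Qed.

(** * Disjoint cones indexed by a finite type *)

Section Code.
Variable T : finType.

(** Indicator words: having equal length and being distinct, they are pairwise incomparable as
    prefixes. *)
Definition code (t : T) : seq bool := [seq x == t | x <- enum T].

Lemma size_code t : size (code t) = #|T|.
Proof. by rewrite size_map -cardE. Qed.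

Lemma code_inj : injective code.
Proof.
move=> s t /eq_in_map st; apply/eqP.
by rewrite -(st s) ?mem_enum ?eqxx.
Qed.

End Code.

(** * The action of the graph group and ping-pong *)

Lemma commutation_rel_eval (G : sgraph) (H : groupType) (h : G -> H) :
  (forall u v, sedge u v -> commute (h u) (h v)) ->
  forall u v, commutation_rel u v -> word_eval h u = word_eval h v.
Proof.
move=> hc _ _ [u v uv]; rewrite /word_eval !big_cons !big_nil !mulg1.
exact: hc.
Qed.

Section PingPong.
Variables (G : sgraph) (T : finType) (cls : G -> T).
Hypothesis clsE : forall u v : G, sedge u v = (cls u != cls v).

Definition letter_map (a : G * bool) : thompsonV :=
  cone_shift (code (cls a.1)) (code (Some a)) (code (Some (inv_letter a))).

Definition vertex_map (v : G) : thompsonV := letter_map (v, true).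

(** Inverting a vertex map exchanges its attracting and repelling cones, which is the same as
    passing to the inverse letter. *)
Lemma letter_evalE a : letter_eval vertex_map a = letter_map a.
Proof. by case: a => v [] //; rewrite /letter_eval cone_shiftV. Qed.

Lemma vertex_map_commute u v : sedge u v -> commute (vertex_map u) (vertex_map v).
Proof.
rewrite clsE => uv; apply: thompsonVP => x; rewrite !thompsonV_mulE.
apply: on_cone_comm; first by rewrite !size_code.
by rewrite (inj_eq (@code_inj _)).
Qed.

Lemma letter_map_base a (o : option (G * bool)) z :
  o != Some (inv_letter a) ->
  val (letter_map a) (cat_word (code (cls a.1)) (cat_word (code o) z)) =
  cat_word (code (cls a.1)) (cat_word (code (Some a)) (cat_word (code o) z)).
Proof.
move=> oa; rewrite [LHS]on_cone_cat /tree_shift take_word_cat ?size_code//.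
by rewrite (inj_eq (@code_inj _)) (negPf oa).
Qed.

Lemma letter_map_out a t z : cls a.1 != t ->
  val (letter_map a) (cat_word (code t) z) = cat_word (code t) z.
Proof.
move=> nt; apply: on_cone_out; rewrite take_word_cat ?size_code//.
by rewrite (inj_eq (@code_inj _)) eq_sym.
Qed.

(* The cones inside the one of t are indexed by optional letters: None is the
   cone of the base points, Some a the attracting cone of a. *)
Lemma ping_pong t r z : all (fun a => cls a.1 == t) r -> reduced r ->
  exists y, val (word_eval vertex_map r)
      (cat_word (code t) (cat_word (code (@None (G * bool))) z)) =
    cat_word (code t) (cat_word (code (ohead r)) y).
Proof.
elim: r => [_ _|a r IH /= /andP[/eqP at' rt] ar].
  by exists z; rewrite word_eval_nil thompsonV_oneE.
have [|y yE] := IH rt; first exact: path_sorted ar.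
rewrite word_eval_cons thompsonV_mulE yE letter_evalE -at' letter_map_base.
  by eexists.
(* The point reached so far lies in the base cone or in the attracting cone of the head of [r]; as
   the word is reduced, neither is the repelling cone of [a]. *)
by case: r ar {IH rt yE} => //= b r /andP[].
Qed.

Lemma word_eval_out t w z : all (fun a => cls a.1 != t) w ->
  val (word_eval vertex_map w) (cat_word (code t) z) = cat_word (code t) z.
Proof.
elim: w => [|a w IH /= /andP[at' /IH{}IH]].
  by rewrite word_eval_nil thompsonV_oneE.
by rewrite word_eval_cons thompsonV_mulE IH letter_evalE letter_map_out.
Qed.

(** Induction on length: the letters in the class of the first letter are gathered on the left,
    ping-pong shows that they form a trivial word, and the remaining word is shorter. *)
Lemma word_eval_faithful w : word_eval vertex_map w = 1 ->
  pres_equiv (@commutation_rel G) w [::].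
Proof.
pose gen := pres_gen (@commutation_rel G).
have gen_comm u v : sedge u v -> commute (gen u) (gen v).
  move=> uv; rewrite /commute [LHS]pres_mulE [RHS]pres_mulE.
  by apply/pres_classP/pres_rel; exact: Commutation.
move=> w1; apply/pres_classP; rewrite !pres_class_eval -/gen word_eval_nil.
have [n] := ubnP (size w); elim: n => // n IH in w w1 *.
case: w w1 => [|a w] w1 ltwn; first by rewrite word_eval_nil.
set v := a :: w in w1 *; pose P (b : G * bool) := cls b.1 == cls a.1.
(* The target group is arbitrary because the splitting serves twice: in [thompsonV] and in the graph
   group. *)
have split_eval (H : groupType) (h : G -> H) :
    (forall b c, sedge b c -> commute (h b) (h c)) ->
    word_eval h v =
      word_eval h [seq b <- v | P b] * word_eval h [seq b <- v | ~~ P b].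
  move=> hc; apply: word_eval_split => b c /eqP Pb Pc.
  by apply/letter_eval_commute/hc; rewrite clsE Pb eq_sym.
have vP1 : pres_equiv (@commutation_rel G) [seq b <- v | P b] [::].
  have [r [vr rr sr]] := free_reduction (@commutation_rel G) [seq b <- v | P b].
  have Pr : all P r by apply/allP => b /sr; rewrite mem_filter => /andP[].
  have [y] := ping_pong (fun=> false) Pr rr.
  rewrite -(word_eval_equiv (commutation_rel_eval vertex_map_commute) vr).
  set z := cat_word _ _.
  (* The letters outside the class act first and fix the cone of this class pointwise. *)
  have <- : val (word_eval vertex_map v) z =
      val (word_eval vertex_map [seq b <- v | P b]) z.
    rewrite (split_eval _ _ vertex_map_commute) thompsonV_mulE.
    by rewrite (@word_eval_out (cls a.1) [seq b <- v | ~~ P b]) ?filter_all.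
  rewrite w1 thompsonV_oneE => /cat_word_inj zy.
  suff r0 : r = [::] by rewrite r0 in vr.
  case: r {vr rr sr Pr} zy => // b r zy.
  (* The base point would also lie in the attracting cone of [b]. *)
  suff : None = Some b :> option (G * bool) by [].
  apply: code_inj; rewrite -(take_cat_word (code None) (fun=> false)) zy /=.
  by rewrite take_word_cat ?size_code.
have drop_P (H : groupType) (h : G -> H) :
    (forall b c, sedge b c -> commute (h b) (h c)) ->
    word_eval h v = word_eval h [seq b <- v | ~~ P b].
  move=> hc; rewrite (split_eval _ _ hc).
  by rewrite (word_eval_equiv (commutation_rel_eval hc) vP1) word_eval_nil mul1g.
rewrite (drop_P _ _ gen_comm); apply: IH.
  by rewrite -(drop_P _ _ vertex_map_commute).
(* The first letter [a] satisfies [P], so filtering strictly shortens the word. *)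
rewrite /v /= /P eqxx /= size_filter.
by apply: leq_ltn_trans (count_size _ _) _; exact: ltwn.
Qed.

Lemma graph_group_embeds_thompsonV :
  exists f : {multiplicative graph_group G -> thompsonV}, injective f.
Proof.
exact: pres_embeds (commutation_rel_eval vertex_map_commute) word_eval_faithful.
Qed.

End PingPong.

(** * From commuting partitions to complete multipartite graphs *)

(** Infinity, coded by [None], is absorbing for [maxdist], so a finite maximum forces every term to
    be finite. *)
Lemma bigmaxdist_le (I : eqType) (r : seq I) (P : pred I) F m :
  \big[maxdist/Some 0%N]_(i <- r | P i) F i = Some m ->
  forall i, i \in r -> P i -> exists2 d, F i = Some d & (d <= m)%N.
Proof.
elim: r m => [//|j r IH] m; rewrite big_cons => Fm i; rewrite inE.
move=> /predU1P[->|ir] Pi.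
  rewrite Pi in Fm; case: (F j) Fm => //= d; case: (bigop _ _) => //= e [<-].
  by exists d => //; exact: leq_maxl.
case: (P j) Fm => [|Fm]; last exact: IH Fm _ ir Pi.
case: (F j) => //= d; case Fe : (bigop _ _) => [e|//] /= [<-].
by have [k -> ke] := IH _ Fe _ ir Pi; exists k => //; rewrite leq_max ke orbT.
Qed.

(** A walk of length 0 would identify the two vertices, so the shortest walk is a single edge. *)
Lemma geodist_le1 (G : sgraph) (u v : G) d :
  geodist u v = Some d -> (d <= 1)%N -> u != v -> sedge u v.
Proof.
rewrite /geodist; case: pselect => // uv [<-]; case: ex_minnP => k /existsP[p].
case/andP; case: k p => [|[|//]] p + + _ _.
  by rewrite (tuple0 p) /= => _ ->.
by case/tupleP: p => x p; rewrite (tuple0 p) /= andbT => ux /eqP <-.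
Qed.

Lemma eccentricity1 (G : sgraph) (u v : G) :
  eccentricity u = Some 1%N -> u != v -> sedge u v.
Proof.
move=> eu uv; have vu : v != u by rewrite eq_sym.
have [d uvd d1] := bigmaxdist_le eu (mem_index_enum v) vu.
exact: geodist_le1 uvd d1 uv.
Qed.

Lemma GP_classes (G : sgraph) : in_GP G ->
  exists (T : finType) (cls : G -> T),
    forall u v : G, sedge u v = (cls u != cls v).
Proof.
move=> [n [P [Ppart _ P0 Pindep Pjoin]]].
have /choice[part partP] (v : G) : exists k, v \in P k.
  by have [k []] := Ppart v; exists k.
exists ('I_n.+1 * option G)%type.
(* The second component cuts the part of index 0 into singletons, its vertices being pairwise
   adjacent; the other parts remain whole. *)
exists (fun v => (part v, if part v == ord0 then Some v else None)) => u v.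
rewrite xpair_eqE negb_and; have [uv|] := eqVneq (part u) (part v); last first.
  by move=> uv; rewrite (Pjoin _ _ uv).
rewrite uv /=; case: (eqVneq (part v) ord0) => [v0|v0].
  have [->|neq] := eqVneq u v; first by rewrite sedge_irr eqxx.
  have -> : Some u != Some v by [].
  by apply: eccentricity1 => //; apply/eqP; have := partP u; rewrite uv v0 P0 inE.
by rewrite eqxx; apply/negbTE/(Pindep _ v0); rewrite ?partP// -uv partP.
Qed.

Theorem lemma5 (G : sgraph) (hG : in_GP G) :
  exists f : {multiplicative graph_group G -> thompsonV}, injective f.
Proof.
have [T [cls clsE]] := GP_classes hG.
exact: graph_group_embeds_thompsonV clsE.
Qed.
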